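(* Suppose that $f(z)=\sum_{n=0}^{\infty}a_nz^n$ belongs to $\mathcal{B}$, $0<p\le2$, $\alpha\in\mathbb{R}$, and for $N\ge1$ let $\Phi_N(r)=\sum_{n=N}^{\infty}(n+1)^{\alpha}r^n$ for $r\in[0,1)$. Then $$|a_0|^p+\sum_{n=1}^{\infty}(n+1)^{\alpha}|a_n|r^n+\sum_{n=1}^{\infty}|a_n|^2\left[\frac{(2n+1)^{\alpha}r^{2n}}{1+|a_0|}+\Phi_{2n+1}(r)\right]\le1\quad\text{for } 0\le r\le R,$$ where $R$ is the minimal positive root in $(0,1)$ of the equation $\Phi_1(r)=p/2$.
   Context: $\mathbb{D}=\{z\in\mathbb{C}:|z|<1\}$. $\mathcal{B}$ is the set of analytic functions $f$ on $\mathbb{D}$ with $\sup_{z\in\mathbb{D}}|f(z)|\le1$. *)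

(* Defs.v *)
From Stdlib Require Import Reals.
From Coquelicot Require Import Coquelicot.

Open Scope R_scope.

(* [x ^ y] for [x >= 0], [y > 0].  Stdlib's [Rpower 0 y] is [1], since
   [ln 0 = 0] there, so the base [0] is treated separately. *)
Definition rpow (x y : R) : R :=
  if Req_EM_T x 0 then 0 else Rpower x y.

(* "Analytic" is complex differentiability at every point of the disk.
   [f] is a total function; its values off the open disk are irrelevant. *)
Definition analytic_on_disk (f : C -> C) : Prop :=
  forall z : C, Cmod z < 1 -> @ex_derive C_AbsRing C_NormedModule f z.

Definition classB (f : C -> C) : Prop :=
  analytic_on_disk f /\ (forall z : C, Cmod z < 1 -> Cmod (f z) <= 1).

Definition taylor_on_disk (f : C -> C) (a : nat -> C) : Prop :=
  forall z : C, Cmod z < 1 -> @is_pseries C_AbsRing C_NormedModule a z (f z).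

(* The sum over [n >= N] is reindexed by [n = N + k].  [Series] is used at
   [0 <= r < 1] only, where this series converges for every [alpha]. *)
Definition Phi (alpha : R) (N : nat) (r : R) : R :=
  Series (fun k => Rpower (INR (N + k + 1)) alpha * r ^ (N + k)).

Definition is_min_root (p alpha R0 : R) : Prop :=
  0 < R0 < 1 /\ Phi alpha 1 R0 = p / 2 /\
  (forall s : R, 0 < s < 1 -> Phi alpha 1 s = p / 2 -> R0 <= s).

Definition term1 (a : nat -> C) (alpha r : R) (n : nat) : R :=
  Rpower (INR (n + 1)) alpha * Cmod (a n) * r ^ n.

Definition term2 (a : nat -> C) (alpha r : R) (n : nat) : R :=
  Cmod (a n) ^ 2 *
  (Rpower (INR (2 * n + 1)) alpha * r ^ (2 * n) / (1 + Cmod (a 0%nat))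
   + Phi alpha (2 * n + 1) r).

(* Main.v *)
Require Import Defs.
From Stdlib Require Import Reals.
From Coquelicot Require Import Coquelicot.
From Stdlib Require Import Lra Lia Compare_dec.
Open Scope R_scope.

(** The proof has three ingredients.

    1. Carlson's inequalities for a power series bounded by 1 on the disk
       ([carlson]):
         |a_(2n+1)| + sum_(k <= n) |a_k|^2 <= 1,
         |a_(2n)| + sum_(k < n) |a_k|^2 + |a_n|^2 / (1 + |a_0|) <= 1.
       For a polynomial u, the coefficient of z^m in f u^2 is the mean of
       f u^2 conj(z)^m over the unit circle, hence at most the mean of |u|^2,
       which is the sum of the squared moduli of the coefficients of u.  Take
       u = 1 + W with W = sum_(2k <= m) v_k z^(m-k).  As W^2 has no term of
       degree below m, the coefficient is essentially linear in v, and a v_k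
       proportional to conj(a_k), with the phase of a_m, gives the
       inequality ([square_multiplier_bound], [carlson_polynomial]).  To have
       only finite sums, the mean is taken over sufficiently many roots of
       unity and f is replaced by the polynomials
       rho * sum_(k <= K) a_k rho^k z^k, which are bounded by 1 on the circle
       for K large; then rho tends to 1 ([carlson_half]).

    2. Summation ([carlson_summed]).  Multiply the inequality for |a_m| by
       w_m = (m+1)^alpha r^m and sum over m >= 1.  In this sum |a_n|^2 is
       collected with total weight w_(2n) / (1 + |a_0|) + sum_(m > 2n) w_m,
       which is exactly the bracket of the theorem.  So both series together
       are at most (1 - |a_0|^2) Phi_1(r).

    3. As Phi_1 increases on [0, 1), Phi_1(r) <= Phi_1(R0) = p/2; and
       x^p + (1 - x^2) p/2 <= 1 because t^(p/2) lies below its tangent at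
       t = 1, where t = x^2 ([rpow_le_tangent]). *)

(** * Finite complex sums *)

(** The sum is retyped in [C] so that the [ring] tactic recognises it. *)
Definition csum (g : nat -> C) (n : nat) : C := @sum_n C_AbelianMonoid g n.

Lemma csum_0 (g : nat -> C) : csum g 0 = g 0%nat.
Proof. exact (sum_O g). Qed.

Lemma csum_S (g : nat -> C) n : csum g (S n) = (csum g n + g (S n))%C.
Proof. exact (sum_Sn g n). Qed.

Lemma csum_ext_loc (g h : nat -> C) n :
  (forall k, (k <= n)%nat -> g k = h k) -> csum g n = csum h n.
Proof. exact (sum_n_ext_loc g h n). Qed.

Lemma csum_ext (g h : nat -> C) n :
  (forall k, g k = h k) -> csum g n = csum h n.
Proof. exact (sum_n_ext g h n). Qed.

Lemma csum_plus (g h : nat -> C) n :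
  csum (fun k => (g k + h k)%C) n = (csum g n + csum h n)%C.
Proof. exact (sum_n_plus (G := C_AbelianMonoid) g h n). Qed.

Lemma csum_mult_l (c : C) (g : nat -> C) n :
  csum (fun k => (c * g k)%C) n = (c * csum g n)%C.
Proof. exact (sum_n_mult_l (K := C_Ring) c g n). Qed.

Lemma csum_mult_r (c : C) (g : nat -> C) n :
  csum (fun k => (g k * c)%C) n = (csum g n * c)%C.
Proof. exact (sum_n_mult_r (K := C_Ring) c g n). Qed.

Lemma csum_conj (g : nat -> C) n :
  Cconj (csum g n) = csum (fun k => Cconj (g k)) n.
Proof.
  induction n as [|n IH]; [now rewrite !csum_0|].
  now rewrite !csum_S, Cplus_conj, IH.
Qed.

Lemma csum_RtoC (g : nat -> R) n :
  csum (fun k => RtoC (g k)) n = RtoC (sum_f_R0 g n).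
Proof.
  induction n as [|n IH]; [now rewrite !csum_0|].
  now rewrite csum_S, IH; simpl; rewrite RtoC_plus.
Qed.

Lemma csum_zero (g : nat -> C) n :
  (forall k, (k <= n)%nat -> g k = RtoC 0) -> csum g n = RtoC 0.
Proof.
  induction n as [|n IH]; intros H; [now rewrite csum_0; apply H|].
  rewrite csum_S, H, IH by (intros; apply H || idtac; lia). ring.
Qed.

Lemma csum_last (g : nat -> C) n :
  (forall k, (k < n)%nat -> g k = RtoC 0) -> csum g n = g n.
Proof.
  destruct n as [|n]; intros H; [now rewrite csum_0|].
  rewrite csum_S, csum_zero by (intros; apply H; lia). ring.
Qed.

Lemma csum_delta (g : nat -> C) i n :
  (i <= n)%nat ->
  csum (fun k => if Nat.eq_dec k i then g k else RtoC 0) n = g i.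
Proof.
  induction n as [|n IH]; intros H.
  - rewrite csum_0. destruct (Nat.eq_dec 0 i) as [<-|]; [easy|lia].
  - rewrite csum_S. destruct (Nat.eq_dec (S n) i) as [<-|Hn].
    + rewrite csum_zero; [ring|]. intros k Hk.
      destruct (Nat.eq_dec k (S n)); [lia|easy].
    + rewrite IH by lia. ring.
Qed.

Lemma csum_Cmod_le (g : nat -> C) (h : nat -> R) n :
  (forall k, (k <= n)%nat -> Cmod (g k) <= h k) -> Cmod (csum g n) <= sum_f_R0 h n.
Proof.
  induction n as [|n IH]; intros H; [now rewrite csum_0; apply H|].
  rewrite csum_S; simpl. eapply Rle_trans; [apply Cmod_triangle|].
  apply Rplus_le_compat; [apply IH; intros; apply H; lia|apply H; lia].
Qed.

Lemma csum_csum_mult (g h : nat -> C) n p :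
  (csum g n * csum h p)%C = csum (fun k => csum (fun l => (g k * h l)%C) p) n.
Proof.
  rewrite <- csum_mult_r. apply csum_ext; intros k.
  now rewrite <- csum_mult_l.
Qed.

Lemma Cconj_RtoC (x : R) : Cconj (RtoC x) = RtoC x.
Proof. unfold Cconj, RtoC; cbn [fst snd]. now rewrite Ropp_0. Qed.

(** * Means over roots of unity *)

Definition omega (N : nat) : C :=
  (cos (2 * PI / INR (S N)), sin (2 * PI / INR (S N))).

Lemma omega_pow N k :
  (omega N ^ k)%C = (cos (INR k * (2 * PI / INR (S N))),
                     sin (INR k * (2 * PI / INR (S N)))).
Proof.
  induction k as [|k IH].
  - simpl INR. rewrite Rmult_0_l, cos_0, sin_0. easy.
  - rewrite Cpow_S, IH, (S_INR k), Rmult_plus_distr_r, Rmult_1_l, cos_plus, sin_plus.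
    unfold omega, Cmult; cbn [fst snd]. f_equal. all: ring.
Qed.

Lemma Cmod_omega N : Cmod (omega N) = 1.
Proof.
  unfold omega, Cmod; cbn [fst snd].
  rewrite <- sqrt_1. f_equal. rewrite <- !Rsqr_pow2, Rplus_comm. apply sin2_cos2.
Qed.

Lemma omega_pow_order N : (omega N ^ S N)%C = RtoC 1.
Proof.
  rewrite omega_pow.
  replace (INR (S N) * (2 * PI / INR (S N))) with (2 * PI)
    by (field; apply not_0_INR; lia).
  now rewrite cos_2PI, sin_2PI.
Qed.

Lemma omega_pow_neq1 N k : (0 < k <= N)%nat -> (omega N ^ k)%C <> RtoC 1.
Proof.
  intros Hk H. rewrite omega_pow in H.
  apply (f_equal fst) in H as Hc. unfold RtoC in Hc; cbn [fst] in Hc.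
  assert (HN : 0 < INR (S N)) by (apply lt_0_INR; lia).
  assert (Hk0 : 0 < INR k) by (apply lt_0_INR; lia).
  assert (HkN : INR k < INR (S N)) by (apply lt_INR; lia).
  set (t := INR k * PI / INR (S N)).
  assert (Ht : 0 < t < PI).
  { pose proof PI_RGT_0. unfold t. split.
    - apply Rdiv_lt_0_compat; [apply Rmult_lt_0_compat|]; lra.
    - apply Rmult_lt_reg_r with (INR (S N)); [easy|]. field_simplify; [|lra].
      rewrite (Rmult_comm PI). apply Rmult_lt_compat_r; lra. }
  replace (INR k * (2 * PI / INR (S N))) with (2 * t) in Hc
    by (unfold t; field; lra).
  rewrite cos_2a_sin in Hc.
  assert (0 < sin t) by (apply sin_gt_0; lra). nra.
Qed.

(** A discrete substitute for the normalised integral over the unit circle: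
    the two agree on trigonometric polynomials of degree at most [N]. *)
Definition mean (N : nat) (g : C -> C) : C :=
  (/ RtoC (INR (S N)) * csum (fun j => g (omega N ^ j)%C) N)%C.

Lemma RtoC_INR_S_neq0 N : RtoC (INR (S N)) <> RtoC 0.
Proof. intros H. apply RtoC_inj in H. revert H. apply not_0_INR; lia. Qed.

Lemma mean_ext N g h :
  (forall w, Cmod w = 1 -> g w = h w) -> mean N g = mean N h.
Proof.
  intros H. unfold mean. f_equal. apply csum_ext; intros j. apply H.
  now rewrite Cmod_pow, Cmod_omega, pow1.
Qed.

Lemma mean_plus N g h :
  mean N (fun w => (g w + h w)%C) = (mean N g + mean N h)%C.
Proof. unfold mean. rewrite csum_plus. ring. Qed.

Lemma mean_scal N c g : mean N (fun w => (c * g w)%C) = (c * mean N g)%C.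
Proof. unfold mean. rewrite csum_mult_l. ring. Qed.

Lemma mean_conj N g : mean N (fun w => Cconj (g w)) = Cconj (mean N g).
Proof.
  unfold mean. rewrite Cmult_conj, csum_conj, Cinv_conj by apply RtoC_INR_S_neq0.
  now rewrite Cconj_RtoC.
Qed.

Lemma mean_csum N (G : nat -> C -> C) n :
  mean N (fun w => csum (fun k => G k w) n) = csum (fun k => mean N (G k)) n.
Proof.
  unfold mean. rewrite csum_mult_l. f_equal.
  exact (sum_n_switch (G := C_AbelianMonoid) (fun j k => G k (omega N ^ j)%C) N n).
Qed.

Lemma csum_const_1 n : csum (fun _ => RtoC 1) n = RtoC (INR (S n)).
Proof.
  rewrite (csum_RtoC (fun _ => 1)), sum_cte. f_equal. ring.
Qed.

Lemma csum_geom q n :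
  (csum (fun j => q ^ j)%C n * (q - 1))%C = (q ^ S n - 1)%C.
Proof.
  induction n as [|n IH].
  - rewrite csum_0, Cpow_S. change (q ^ 0)%C with (RtoC 1). ring.
  - rewrite csum_S, Cmult_plus_distr_r, IH, !Cpow_S. ring.
Qed.

Lemma mean_pow N k :
  (k <= N)%nat ->
  mean N (fun w => (w ^ k)%C) = if Nat.eq_dec k 0 then RtoC 1 else RtoC 0.
Proof.
  intros Hk. unfold mean. destruct (Nat.eq_dec k 0) as [->|H0].
  - rewrite (csum_ext _ (fun _ => RtoC 1)) by (intros; reflexivity).
    rewrite csum_const_1. apply Cinv_l, RtoC_INR_S_neq0.
  - set (q := (omega N ^ k)%C).
    rewrite (csum_ext _ (fun j => q ^ j)%C)
      by (intros j; unfold q; rewrite <- !Cpow_mult_r; f_equal; lia).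
    assert (Hq : (q - 1)%C <> RtoC 0).
    { intros E. apply (omega_pow_neq1 N k); [lia|]. fold q.
      replace q with (q - 1 + 1)%C by ring. rewrite E. ring. }
    assert (E : (csum (fun j => q ^ j)%C N * (q - 1))%C = RtoC 0).
    { rewrite csum_geom. unfold q. rewrite <- Cpow_mult_r, Nat.mul_comm,
        Cpow_mult_r, omega_pow_order, Cpow_1_l. ring. }
    replace (csum (fun j => q ^ j)%C N)
      with (csum (fun j => q ^ j)%C N * (q - 1) * / (q - 1))%C by (field; easy).
    rewrite E. ring.
Qed.

Lemma Cmult_conj_unit w : Cmod w = 1 -> (w * Cconj w)%C = RtoC 1.
Proof. intros H. rewrite <- Cmod2_conj, H. f_equal. ring. Qed.

Lemma pow_conj_unit w i j :
  Cmod w = 1 -> (w ^ (i + j) * Cconj w ^ i)%C = (w ^ j)%C.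
Proof.
  intros H. rewrite Cpow_add_r.
  replace (w ^ i * w ^ j * Cconj w ^ i)%C with (w ^ i * Cconj w ^ i * w ^ j)%C by ring.
  rewrite <- Cpow_mult_l, Cmult_conj_unit, Cpow_1_l by easy. ring.
Qed.

(** Orthonormality of the powers [w ^ i], [i <= N]. *)
Lemma mean_pow_conj N i j :
  (i <= N)%nat -> (j <= N)%nat ->
  mean N (fun w => (w ^ i * Cconj w ^ j)%C) =
  if Nat.eq_dec i j then RtoC 1 else RtoC 0.
Proof.
  intros Hi Hj. destruct (Nat.le_gt_cases j i) as [H|H].
  - rewrite (mean_ext _ _ (fun w => w ^ (i - j))%C).
    + rewrite mean_pow by lia.
      destruct (Nat.eq_dec (i - j) 0), (Nat.eq_dec i j); easy || lia.
    + intros w Hw. rewrite <- (pow_conj_unit w j (i - j) Hw).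
      do 2 f_equal. lia.
  - rewrite (mean_ext _ _ (fun w => Cconj (w ^ (j - i)))%C).
    + rewrite mean_conj, mean_pow by lia.
      destruct (Nat.eq_dec (j - i) 0), (Nat.eq_dec i j); try lia.
      apply Cconj_RtoC.
    + intros w Hw. rewrite <- (pow_conj_unit w i (j - i) Hw), Cmult_conj,
        !Cpow_conj, Cconj_conj.
      replace (i + (j - i))%nat with j by lia. ring.
Qed.

(** The bound [H] is given through the complex [mean] of [h], so that it can be
    evaluated by the orthogonality relations. *)
Lemma mean_Cmod_le N g (h : C -> R) H :
  (forall w, Cmod w = 1 -> Cmod (g w) <= h w) ->
  mean N (fun w => RtoC (h w)) = RtoC H -> Cmod (mean N g) <= H.
Proof.
  intros Hgh HH.
  assert (HN : 0 < INR (S N)) by (apply lt_0_INR; lia).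
  assert (E : / INR (S N) * sum_f_R0 (fun j => h (omega N ^ j)%C) N = H).
  { apply RtoC_inj. rewrite <- HH. unfold mean.
    rewrite csum_RtoC, RtoC_mult, RtoC_inv by lra. easy. }
  unfold mean. rewrite Cmod_mult, Cmod_inv, Cmod_R, Rabs_pos_eq, <- E
    by (apply RtoC_INR_S_neq0 || lra).
  apply Rmult_le_compat_l; [left; now apply Rinv_0_lt_compat|].
  apply csum_Cmod_le; intros j _. apply Hgh.
  now rewrite Cmod_pow, Cmod_omega, pow1.
Qed.

(** The polynomial times [w ^ q] still has degree at most [N], so none of its
    powers is identified with another on the [N + 1] roots of unity. *)
Lemma mean_coef N (b : nat -> C) K q m :
  (K + q <= N)%nat -> (m <= N)%nat -> (m <= K)%nat ->
  mean N (fun w => (csum (fun k => b k * w ^ k) K * w ^ q * Cconj w ^ m)%C) =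
  if le_dec q m then b (m - q)%nat else RtoC 0.
Proof.
  intros HN Hm HK.
  rewrite (mean_ext _ _ (fun w =>
    csum (fun k => b k * (w ^ (k + q) * Cconj w ^ m)) K)%C).
  2:{ intros w _. rewrite <- !csum_mult_r. apply csum_ext; intros k.
      rewrite Cpow_add_r. ring. }
  rewrite mean_csum.
  rewrite (csum_ext_loc _ (fun k =>
     if Nat.eq_dec (k + q) m then b k else RtoC 0)).
  2:{ intros k Hk. rewrite mean_scal, mean_pow_conj by lia.
      destruct (Nat.eq_dec (k + q) m); ring. }
  destruct (le_dec q m) as [Hq|Hq].
  - rewrite (csum_ext _ (fun k => if Nat.eq_dec k (m - q) then b k else RtoC 0)).
    + now rewrite csum_delta by lia.
    + intros k. destruct (Nat.eq_dec (k + q) m), (Nat.eq_dec k (m - q)); easy || lia.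
  - apply csum_zero. intros k _. destruct (Nat.eq_dec (k + q) m); easy || lia.
Qed.

(** Parseval's identity for [1 + sum v_k w^(m-k)]; the bound [h < m] keeps the
    constant term apart from the others. *)
Lemma mean_square_trig N (v : nat -> C) m h :
  (h < m <= N)%nat ->
  mean N (fun w => RtoC (Cmod (1 + csum (fun k => v k * w ^ (m - k)) h)%C ^ 2)) =
  RtoC (1 + sum_f_R0 (fun k => Cmod (v k) ^ 2) h).
Proof.
  intros Hh.
  set (W := fun w => csum (fun k => v k * w ^ (m - k))%C h).
  set (T := fun k l w =>
    (v k * Cconj (v l) * (w ^ (m - k) * Cconj w ^ (m - l)))%C).
  assert (HW : mean N W = RtoC 0).
  { unfold W. rewrite mean_csum. apply csum_zero. intros k Hk.
    rewrite mean_scal, mean_pow by lia.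
    destruct (Nat.eq_dec (m - k) 0); [lia|ring]. }
  assert (HT : mean N (fun w => csum (fun k => csum (fun l => T k l w) h) h) =
               csum (fun k => RtoC (Cmod (v k) ^ 2)) h).
  { rewrite mean_csum. apply csum_ext_loc. intros k Hk.
    rewrite mean_csum, Cmod2_conj.
    rewrite <- (csum_delta (fun l => v k * Cconj (v l))%C k h Hk).
    apply csum_ext_loc. intros l Hl. unfold T.
    rewrite mean_scal, mean_pow_conj by lia.
    destruct (Nat.eq_dec (m - k) (m - l)), (Nat.eq_dec l k); try lia; ring. }
  rewrite (mean_ext _ _ (fun w => 1 * w ^ 0 + (W w + (Cconj (W w)
    + csum (fun k => csum (fun l => T k l w) h) h)))%C).
  2:{ intros w _. rewrite Cmod2_conj, Cplus_conj, Cconj_RtoC. fold (W w).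
      rewrite (csum_ext (fun k => csum _ h) (fun k => csum (fun l =>
        (v k * w ^ (m - k)) * Cconj (v l * w ^ (m - l)))%C h)).
      2:{ intros k. apply csum_ext; intros l. unfold T.
          rewrite Cmult_conj, Cpow_conj. ring. }
      rewrite <- csum_csum_mult, <- csum_conj. fold (W w).
      change (w ^ 0)%C with (RtoC 1). ring. }
  rewrite !mean_plus, mean_conj, HW, HT, mean_scal, mean_pow, Cconj_RtoC by lia.
  rewrite RtoC_plus, <- csum_RtoC. simpl. ring.
Qed.

(** * Carlson's inequalities *)

(** The left-hand side is the coefficient of [w ^ m] in [P * (1 + W) ^ 2] with
    [P = sum b_k w^k] and [W = sum v_k w^(m-k)], thus the mean of this product
    against [Cconj w ^ m]; as [|P| <= 1] on the circle, it is at most the mean of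
    [|1 + W| ^ 2], the right-hand side.  The terms of [W ^ 2] have degree
    [2 * m - k - l >= 2 * m - 2 * h >= m], with equality only if [k = l = h]
    and [2 * h = m]: this is the origin of the case distinction. *)
Lemma square_multiplier_bound (b v : nat -> C) K m h :
  (forall w, Cmod w = 1 -> Cmod (csum (fun k => b k * w ^ k)%C K) <= 1) ->
  (m <= K)%nat -> (h < m)%nat -> (2 * h <= m)%nat ->
  Cmod (b m + 2 * csum (fun k => v k * b k) h
        + (if Nat.eq_dec (2 * h) m then b 0%nat else 0) * v h ^ 2)%C
  <= 1 + sum_f_R0 (fun k => Cmod (v k) ^ 2) h.
Proof.
  intros HS HK Hh H2.
  (* the degree of [P * (1 + W) ^ 2] is at most [K + 2 * m] *)
  set (N := (K + 2 * m)%nat).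
  set (P := fun w => csum (fun k => b k * w ^ k)%C K).
  set (W := fun w => csum (fun k => v k * w ^ (m - k))%C h).
  assert (E : mean N (fun w => P w * (1 + W w) ^ 2 * Cconj w ^ m)%C =
     (b m + 2 * csum (fun k => v k * b k) h
        + (if Nat.eq_dec (2 * h) m then b 0%nat else 0) * v h ^ 2)%C).
  { rewrite (mean_ext _ _ (fun w => P w * w ^ 0 * Cconj w ^ m +
     (2 * csum (fun k => v k * (P w * w ^ (m - k) * Cconj w ^ m)) h +
      csum (fun k => csum (fun l =>
         (v k * v l) * (P w * w ^ ((m - k) + (m - l)) * Cconj w ^ m)) h) h))%C).
    2:{ intros w _.
      rewrite (csum_ext (fun k => csum _ h)
       (fun k => csum (fun l => (v k * w ^ (m - k)) * (v l * w ^ (m - l)))%C h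
                 * (P w * Cconj w ^ m))%C).
      2:{ intros k. rewrite <- csum_mult_r. apply csum_ext; intros l.
          rewrite Cpow_add_r. ring. }
      rewrite csum_mult_r, <- csum_csum_mult. fold (W w).
      rewrite (csum_ext (fun k => v k * (P w * w ^ (m - k) * Cconj w ^ m))%C
         (fun k => v k * w ^ (m - k) * (P w * Cconj w ^ m))%C) by (intros; ring).
      rewrite csum_mult_r. fold (W w). rewrite !Cpow_S.
      change (w ^ 0)%C with (RtoC 1). change ((1 + W w) ^ 0)%C with (RtoC 1). ring. }
    rewrite !mean_plus, mean_scal, !mean_csum.
    unfold P at 1. rewrite mean_coef by lia.
    destruct (le_dec 0 m) as [_|]; [|lia]. rewrite Nat.sub_0_r.
    rewrite <- Cplus_assoc. f_equal. f_equal.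
    - f_equal. apply csum_ext_loc; intros k Hk.
      rewrite mean_scal. unfold P. rewrite mean_coef by lia.
      destruct (le_dec (m - k) m); [|lia]. do 2 f_equal. lia.
    - assert (F : forall k l, (k <= h)%nat -> (l <= h)%nat ->
        mean N (fun w => v k * v l * (P w * w ^ (m - k + (m - l)) * Cconj w ^ m))%C
        = (v k * v l * (if le_dec (m - k + (m - l)) m
                        then b (m - (m - k + (m - l)))%nat else 0))%C).
      { intros k l Hk Hl. rewrite mean_scal. unfold P. now rewrite mean_coef by lia. }
      rewrite csum_last.
      + rewrite mean_csum, csum_last; rewrite ?F by lia.
        * destruct (le_dec (m - h + (m - h)) m), (Nat.eq_dec (2 * h) m); try lia.
          -- replace (m - (m - h + (m - h)))%nat with 0%nat by lia. rewrite !Cpow_S.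
             change (v h ^ 0)%C with (RtoC 1). ring.
          -- ring.
        * intros l Hl. rewrite F by lia.
          destruct (le_dec (m - h + (m - l)) m); [lia|ring].
      + intros k Hk. rewrite mean_csum. apply csum_zero. intros l Hl. rewrite F by lia.
        destruct (le_dec (m - k + (m - l)) m); [lia|ring]. }
  rewrite <- E.
  apply mean_Cmod_le with (h := fun w => Cmod (1 + W w)%C ^ 2).
  - intros w Hw. rewrite !Cmod_mult, !Cmod_pow, Cmod_conj, Hw, pow1, Rmult_1_r.
    rewrite <- (Rmult_1_l (Cmod (1 + W w)%C ^ 2)) at 2.
    apply Rmult_le_compat_r; [apply pow_le, Cmod_ge_0|]. now apply HS.
  - unfold W. apply mean_square_trig. lia.
Qed.

(** The coefficient of [|a_n| ^ 2] in Carlson's inequality for [|a_m|], with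
    [c = |a_0|]; one formula covers both parities of [m]. *)
Definition kappa (c : R) (n m : nat) : R :=
  if lt_dec (2 * n) m then 1
  else if Nat.eq_dec (2 * n) m then / (1 + c) else 0.

Lemma kappa_nonneg c n m : 0 <= c -> 0 <= kappa c n m.
Proof.
  intros Hc. unfold kappa. destruct (lt_dec _ _); [lra|].
  destruct (Nat.eq_dec _ _); [|lra]. left; apply Rinv_0_lt_compat; lra.
Qed.

Lemma kappa_antitone c d n m : 0 <= c <= d -> kappa d n m <= kappa c n m.
Proof.
  intros Hc. unfold kappa. destruct (lt_dec _ _); [lra|].
  destruct (Nat.eq_dec _ _); [|lra]. apply Rinv_le_contravar; lra.
Qed.

Lemma phase z : exists t : C, Cmod t = 1 /\ (t * RtoC (Cmod z))%C = z.
Proof.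
  destruct (Ceq_dec z 0) as [->|Hz].
  - exists (RtoC 1). rewrite Cmod_1, Cmod_0. split; [easy|ring].
  - assert (Hm : 0 < Cmod z) by now apply Cmod_gt_0.
    assert (Hm' : RtoC (Cmod z) <> RtoC 0)
      by (intros E; apply RtoC_inj in E; lra).
    exists (z / Cmod z)%C. split.
    + rewrite Cmod_div, Cmod_R, Rabs_pos_eq by (easy || lra). field. lra.
    + field. easy.
Qed.

Lemma sum_eq_but_last (g h : nat -> R) n :
  (forall k, (k < n)%nat -> g k = h k) ->
  sum_f_R0 g n - g n = sum_f_R0 h n - h n.
Proof.
  destruct n as [|n]; intros H; simpl; [ring|].
  rewrite (sum_eq g h n); [ring|]. intros; apply H; lia.
Qed.

(** Let [t] be the phase of [b_m], write [q_k] for the value of [kappa] and put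
    [v_k = t * q_k * Cconj b_k] in the quadratic bound above.  The linear terms
    add up to [t * (|b_m| + 2 sum q_k |b_k|^2)], the right-hand side is
    [1 + sum q_k^2 |b_k|^2], and the exceptional quadratic term [c * v_h ^ 2]
    costs at most [|c| q_h^2 |b_h|^2].  At the index [h] the net gain
    [2 q - (1 + |c|) q^2] is largest for [q = 1 / (1 + |c|)], where it equals
    [q]; at the other indices [2 q - q^2] is largest for [q = 1]. *)
Lemma carlson_polynomial (b : nat -> C) K m h :
  (forall w, Cmod w = 1 -> Cmod (csum (fun k => b k * w ^ k)%C K) <= 1) ->
  (0 < m <= K)%nat -> (2 * h <= m < 2 * h + 2)%nat ->
  Cmod (b m)
  + sum_f_R0 (fun k => kappa (Cmod (b 0%nat)) k m * Cmod (b k) ^ 2) h <= 1.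
Proof.
  intros HS Hm Hh.
  destruct (phase (b m)) as [t [Ht1 Ht2]].
  set (x := fun k => Cmod (b k)). set (ka := fun k => kappa (x 0%nat) k m).
  assert (Hx : forall k, 0 <= x k) by (intros; apply Cmod_ge_0).
  assert (Hka : forall k, 0 <= ka k) by (intros; now apply kappa_nonneg).
  set (v := fun k => (t * RtoC (ka k) * Cconj (b k))%C).
  pose proof (square_multiplier_bound b v K m h HS) as B.
  specialize (B ltac:(lia) ltac:(lia) ltac:(lia)).
  set (c := if Nat.eq_dec (2 * h) m then b 0%nat else RtoC 0) in *.
  set (s := sum_f_R0 (fun k => ka k * x k ^ 2) h).
  change (x m + s <= 1).
  rewrite (csum_ext (fun k => v k * b k)%C (fun k => t * RtoC (ka k * x k ^ 2))%C) in B.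
  2:{ intros k. rewrite RtoC_mult. unfold x. rewrite Cmod2_conj. unfold v. ring. }
  rewrite csum_mult_l, csum_RtoC in B. fold s in B.
  assert (Hv : forall k, Cmod (v k) = ka k * x k).
  { intros k. unfold v.
    now rewrite !Cmod_mult, Cmod_R, Cmod_conj, Ht1, Rabs_pos_eq, Rmult_1_l. }
  rewrite (sum_eq _ (fun k => ka k ^ 2 * x k ^ 2)) in B
    by (intros k _; rewrite Hv; ring).
  assert (Hs : 0 <= s).
  { apply cond_pos_sum. intros k. apply Rmult_le_pos; [easy|]. apply pow2_ge_0. }
  assert (L : x m + 2 * s <= 1 + sum_f_R0 (fun k => ka k ^ 2 * x k ^ 2) h
                             + Cmod c * (ka h * x h) ^ 2).
  { rewrite <- Hv, <- Cmod_pow, <- Cmod_mult.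
    replace (x m + 2 * s) with (Cmod (t * RtoC (x m + 2 * s))%C).
    2:{ rewrite Cmod_mult, Ht1, Cmod_R, Rabs_pos_eq; [ring|]. specialize (Hx m). lra. }
    replace (t * RtoC (x m + 2 * s))%C with
      ((b m + 2 * (t * s) + c * v h ^ 2) + - (c * v h ^ 2))%C.
    2:{ rewrite RtoC_plus, RtoC_mult. rewrite <- Ht2 at 1. fold (x m). ring. }
    eapply Rle_trans; [apply Cmod_triangle|]. rewrite Cmod_opp.
    now apply Rplus_le_compat_r. }
  pose proof (sum_eq_but_last (fun k => ka k ^ 2 * x k ^ 2)
                (fun k => ka k * x k ^ 2) h) as D.
  cbv beta in D. fold s in D. lapply D; clear D.
  2:{ intros k Hk. unfold ka, kappa. destruct (lt_dec (2 * k) m); [ring|lia]. }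
  intros D.
  (* the two losses at index [h], [q_h^2] and [|c| q_h^2], add up to [q_h] *)
  assert (E : ka h ^ 2 * (1 + Cmod c) = ka h).
  { unfold ka, kappa, c. destruct (lt_dec (2 * h) m), (Nat.eq_dec (2 * h) m);
      try lia.
    - rewrite Cmod_0. ring.
    - fold (x 0%nat). specialize (Hx 0%nat). field. lra. }
  assert (E' : ka h ^ 2 * x h ^ 2 + Cmod c * (ka h * x h) ^ 2 = ka h * x h ^ 2).
  { rewrite <- E at 3. ring. }
  lra.
Qed.

Lemma is_pseries_csum (a : nat -> C) z l :
  @is_pseries C_AbsRing C_NormedModule a z l ->
  forall eps, 0 < eps -> exists N, forall n, (N <= n)%nat ->
  Cmod (csum (fun k => a k * z ^ k)%C n - l)%C < eps.
Proof.
  intros H eps Heps.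
  assert (L : locally (T := C_NormedModule) l (fun y : C => Cmod (y - l)%C < eps)).
  { apply (locally_le_locally_norm (K := C_AbsRing) (V := C_NormedModule)).
    exists (mkposreal eps Heps). intros y Hy. exact Hy. }
  destruct (H _ L) as [N HN]. exists N. intros n Hn. specialize (HN n Hn).
  rewrite (csum_ext _ (fun k => z ^ k * a k)%C); [exact HN|].
  intros k. apply Cmult_comm.
Qed.

(** The partial sums converge uniformly on the circle of radius [rho < 1]:
    convergence at a point [s] of [(rho, 1)] bounds [|a_k| s^k] by 2 for large
    [k], so the tail on the circle is dominated by a geometric series of
    ratio [rho / s]. *)
Lemma pseries_partial_sum_bound (f : C -> C) (a : nat -> C) rho eps :
  taylor_on_disk f a -> 0 < rho < 1 -> 0 < eps ->
  exists N, forall K w, (N <= K)%nat -> Cmod w = 1 ->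
  Cmod (csum (fun k => a k * (rho * w) ^ k) K - f (rho * w))%C <= eps.
Proof.
  intros Ha Hrho Heps.
  set (s := (1 + rho) / 2). assert (Hs : rho < s < 1) by (unfold s; lra).
  assert (Hcs : Cmod (RtoC s) < 1) by (rewrite Cmod_R, Rabs_pos_eq; lra).
  destruct (is_pseries_csum a (RtoC s) _ (Ha s Hcs) 1 Rlt_0_1) as [N1 HN1].
  assert (Hterm : forall k, (N1 < k)%nat -> Cmod (a k) * s ^ k <= 2).
  { intros [|k] Hk; [lia|].
    pose proof (HN1 k ltac:(lia)) as A1. pose proof (HN1 (S k) ltac:(lia)) as A2.
    rewrite csum_S in A2.
    rewrite <- (Rabs_pos_eq s) by lra. rewrite <- Cmod_R, <- Cmod_pow, <- Cmod_mult.
    set (S1 := csum (fun k => a k * s ^ k)%C k) in *.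
    replace (a (S k) * s ^ S k)%C with
      ((S1 + a (S k) * s ^ S k - f s) + - (S1 - f s))%C by ring.
    eapply Rle_trans; [apply Cmod_triangle|]. rewrite Cmod_opp. lra. }
  set (q := rho / s).
  assert (Hq : 0 < q < 1).
  { unfold q. split; [apply Rdiv_lt_0_compat; lra|].
    apply Rmult_lt_reg_r with s; [lra|]. field_simplify; lra. }
  (* makes the geometric tail [2 * q^(K+1) / (1 - q)] at most [eps / 2] *)
  destruct (pow_lt_1_zero q ltac:(rewrite Rabs_pos_eq; lra) (eps * (1 - q) / 4))
    as [N2 HN2].
  { apply Rdiv_lt_0_compat; [|lra]. apply Rmult_lt_0_compat; lra. }
  exists (N1 + N2)%nat. intros K w HK Hw.
  set (P := csum (fun k => a k * (rho * w) ^ k)%C).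
  assert (Hd : forall d, Cmod (P (K + d)%nat - P K)%C
                     <= 2 * (q ^ S K - q ^ S (K + d)) / (1 - q)).
  { induction d as [|d IH].
    - rewrite Nat.add_0_r. replace (P K - P K)%C with (RtoC 0) by ring.
      rewrite Cmod_0. right. field. lra.
    - rewrite Nat.add_succ_r. unfold P at 1. rewrite csum_S. fold (P (K + d)%nat).
      set (n := S (K + d)) in *.
      replace (P (K + d)%nat + a n * (rho * w) ^ n - P K)%C with
        ((P (K + d)%nat - P K) + a n * (rho * w) ^ n)%C by ring.
      eapply Rle_trans; [apply Cmod_triangle|].
      replace (2 * (q ^ S K - q ^ S n) / (1 - q)) with
        (2 * (q ^ S K - q ^ n) / (1 - q) + 2 * q ^ n)
        by (simpl; field; lra).
      apply Rplus_le_compat; [exact IH|].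
      rewrite Cmod_mult, Cmod_pow, Cmod_mult, Hw, Cmod_R, Rabs_pos_eq, Rmult_1_r by lra.
      replace (rho ^ n) with (s ^ n * q ^ n).
      2:{ rewrite <- Rpow_mult_distr. f_equal. unfold q. field. lra. }
      rewrite <- Rmult_assoc. apply Rmult_le_compat_r; [apply pow_le; lra|].
      apply Hterm. unfold n. lia. }
  assert (Hz : Cmod (rho * w)%C < 1).
  { rewrite Cmod_mult, Hw, Cmod_R, Rabs_pos_eq; lra. }
  destruct (is_pseries_csum a _ _ (Ha _ Hz) (eps / 2) ltac:(lra)) as [N3 HN3].
  specialize (HN3 (K + N3)%nat ltac:(lia)). fold P in HN3.
  replace (P K - f (rho * w))%C with
    ((P (K + N3)%nat - f (rho * w)) + - (P (K + N3)%nat - P K))%C by ring.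
  eapply Rle_trans; [apply Cmod_triangle|]. rewrite Cmod_opp.
  specialize (HN2 (S K) ltac:(lia)). rewrite Rabs_pos_eq in HN2 by (apply pow_le; lra).
  assert (Cmod (P (K + N3)%nat - P K)%C <= eps / 2).
  { eapply Rle_trans; [apply Hd|].
    apply Rmult_le_reg_r with (1 - q); [lra|].
    assert (0 <= q ^ S (K + N3)) by (apply pow_le; lra).
    unfold Rdiv at 1. rewrite Rmult_assoc, Rinv_l by lra. lra. }
  lra.
Qed.

Lemma pow_ge_linear rho n : 0 <= rho <= 1 -> 1 - INR n * (1 - rho) <= rho ^ n.
Proof.
  intros H. induction n as [|n IH]; [simpl; lra|].
  rewrite S_INR. simpl. pose proof (pos_INR n).
  assert (rho * (1 - INR n * (1 - rho)) <= rho * rho ^ n)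
    by (apply Rmult_le_compat_l; lra).
  assert (0 <= INR n * (1 - rho) * (1 - rho)) by (repeat apply Rmult_le_pos; lra).
  lra.
Qed.

(** The passage [rho -> 1], made explicit with Bernoulli's inequality. *)
Lemma le_1_of_pow_mult_le X n :
  (forall rho, 0 < rho < 1 -> rho ^ n * X <= 1) -> X <= 1.
Proof.
  intros H. destruct (Rle_lt_dec X 1) as [|HX]; [easy|exfalso].
  pose proof (pos_INR n).
  assert (HD : 0 < 2 * (INR n + 1) * X) by (apply Rmult_lt_0_compat; lra).
  set (t := (X - 1) / (2 * (INR n + 1) * X)).
  assert (Ht : 2 * (INR n + 1) * X * t = X - 1).
  { unfold t. field. split; lra. }
  assert (0 < t) by (apply Rdiv_lt_0_compat; lra).
  assert (0 <= INR n * t) by (apply Rmult_le_pos; lra).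
  assert (t < 1) by nra.
  pose proof (pow_ge_linear (1 - t) n ltac:(lra)) as P.
  replace (1 - (1 - t)) with t in P by ring.
  specialize (H (1 - t) ltac:(lra)).
  assert ((1 - INR n * t) * X <= (1 - t) ^ n * X) by (apply Rmult_le_compat_r; lra).
  nra.
Qed.

Lemma pow_antitone rho i j : 0 <= rho <= 1 -> (i <= j)%nat -> rho ^ j <= rho ^ i.
Proof.
  intros H Hij. replace j with (i + (j - i))%nat by lia. rewrite pow_add.
  rewrite <- (Rmult_1_r (rho ^ i)) at 2.
  apply Rmult_le_compat_l; [apply pow_le; lra|].
  rewrite <- (pow1 (j - i)). apply pow_incr; lra.
Qed.

(** The polynomial with coefficients [rho^(k+1) a_k], [k <= N + m], is bounded
    by 1: the factor [rho] in excess absorbs the truncation error.  In its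
    Carlson inequality every power of [rho] is at least [rho^(m+2)], because
    [2 * k + 2 <= m + 2], and replacing [rho * |a_0|] by [|a_0|] lowers
    [kappa]. *)
Lemma carlson_half (f : C -> C) (a : nat -> C) m h :
  taylor_on_disk f a -> (forall z, Cmod z < 1 -> Cmod (f z) <= 1) ->
  (0 < m)%nat -> (2 * h <= m < 2 * h + 2)%nat ->
  Cmod (a m)
  + sum_f_R0 (fun k => kappa (Cmod (a 0%nat)) k m * Cmod (a k) ^ 2) h <= 1.
Proof.
  intros Ha Hf Hm Hh. apply (le_1_of_pow_mult_le _ (m + 2)). intros rho Hrho.
  (* the truncation error for which [rho * (1 + eps) = 1] *)
  set (eps := / rho - 1).
  assert (Heps : 0 < eps).
  { unfold eps. assert (1 < / rho); [|lra]. rewrite <- Rinv_1.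
    apply Rinv_lt_contravar; lra. }
  destruct (pseries_partial_sum_bound f a rho eps Ha Hrho Heps) as [N HN].
  set (b := fun k => (RtoC (rho ^ S k) * a k)%C).
  assert (Hb : forall k, Cmod (b k) = rho ^ S k * Cmod (a k)).
  { intros k. unfold b. rewrite Cmod_mult, Cmod_R, Rabs_pos_eq; [easy|].
    apply pow_le; lra. }
  pose proof (carlson_polynomial b (N + m) m h) as B. lapply B; clear B.
  2:{ intros w Hw.
      assert (Hz : Cmod (rho * w)%C < 1) by (rewrite Cmod_mult, Hw, Cmod_R, Rabs_pos_eq; lra).
      rewrite (csum_ext _ (fun k => rho * (a k * (rho * w) ^ k))%C).
      2:{ intros k. unfold b. rewrite Cpow_mult_l, <- RtoC_pow. simpl.
          rewrite RtoC_mult. ring. }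
      rewrite csum_mult_l, Cmod_mult, Cmod_R, Rabs_pos_eq by lra.
      specialize (HN (N + m)%nat w ltac:(lia) Hw).
      set (P := csum _ _) in *.
      assert (Cmod P <= 1 + eps).
      { replace P with ((P - f (rho * w)) + f (rho * w))%C by ring.
        eapply Rle_trans; [apply Cmod_triangle|]. specialize (Hf _ Hz). lra. }
      apply Rle_trans with (rho * (1 + eps)); [apply Rmult_le_compat_l; lra|].
      right. unfold eps. field. lra. }
  intros B. specialize (B ltac:(lia) Hh).
  eapply Rle_trans; [|exact B].
  rewrite Rmult_plus_distr_l, scal_sum.
  apply Rplus_le_compat.
  - rewrite Hb. apply Rmult_le_compat_r; [apply Cmod_ge_0|]. apply pow_antitone; lia || lra.
  - apply sum_Rle. intros k Hk. rewrite !Hb.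
    pose proof (Cmod_ge_0 (a k)). pose proof (Cmod_ge_0 (a 0%nat)).
    assert (Hr : 0 < rho ^ 1 <= 1) by (simpl; lra).
    rewrite Rpow_mult_distr, <- pow_mult.
    replace (kappa (Cmod (a 0%nat)) k m * Cmod (a k) ^ 2 * rho ^ (m + 2))
      with (kappa (Cmod (a 0%nat)) k m * (rho ^ (m + 2) * Cmod (a k) ^ 2)) by ring.
    apply Rmult_le_compat.
    + apply kappa_nonneg; easy.
    + apply Rmult_le_pos; [apply pow_le; lra|apply pow2_ge_0].
    + apply kappa_antitone. split; [apply Rmult_le_pos; lra|].
      rewrite <- (Rmult_1_l (Cmod (a 0%nat))) at 2. apply Rmult_le_compat_r; lra.
    + apply Rmult_le_compat_r; [apply pow2_ge_0|]. apply pow_antitone; lia || lra.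
Qed.

Lemma sum_le_of_zero_after (g : nat -> R) h L :
  (forall k, 0 <= g k) -> (forall k, (h < k)%nat -> g k = 0) ->
  sum_f_R0 g L <= sum_f_R0 g h.
Proof.
  intros Hg H0. destruct (le_lt_dec L h) as [H|H].
  - replace h with ((h - L) + L)%nat by lia.
    induction (h - L)%nat as [|d IH]; [apply Rle_refl|].
    simpl. specialize (Hg (S (d + L))). lra.
  - replace L with ((L - h) + h)%nat by lia.
    induction (L - h)%nat as [|d IH]; [apply Rle_refl|].
    simpl. rewrite H0 by lia. lra.
Qed.

(** The sum may run up to any [L], as [kappa] vanishes for [2 * n > m]; this
    independence of [m] is what the interchange of sums needs. *)
Theorem carlson (f : C -> C) (a : nat -> C) m L :
  taylor_on_disk f a -> (forall z, Cmod z < 1 -> Cmod (f z) <= 1) ->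
  (0 < m)%nat ->
  Cmod (a m)
  + sum_f_R0 (fun k => kappa (Cmod (a 0%nat)) k m * Cmod (a k) ^ 2) L <= 1.
Proof.
  intros Ha Hf Hm. pose proof (Nat.div_mod_eq m 2). pose proof (Nat.mod_upper_bound m 2).
  eapply Rle_trans; [|apply (carlson_half f a m (m / 2)); easy || lia].
  apply Rplus_le_compat_l, sum_le_of_zero_after.
  - intros k. apply Rmult_le_pos; [apply kappa_nonneg, Cmod_ge_0|apply pow2_ge_0].
  - intros k Hk. unfold kappa.
    destruct (lt_dec (2 * k) m), (Nat.eq_dec (2 * k) m); lia || ring.
Qed.

(** * The weights and their series *)

Definition weight (alpha r : R) (n : nat) : R :=
  Rpower (INR (n + 1)) alpha * r ^ n.

Lemma weight_nonneg alpha r n : 0 <= r -> 0 <= weight alpha r n.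
Proof.
  intros Hr. apply Rmult_le_pos; [left; apply exp_pos|now apply pow_le].
Qed.

Lemma weight_monotone alpha r s n : 0 <= r <= s -> weight alpha r n <= weight alpha s n.
Proof.
  intros Hr. apply Rmult_le_compat_l; [left; apply exp_pos|now apply pow_incr].
Qed.

Lemma is_lim_seq_Rpower_ratio alpha :
  is_lim_seq (fun n => Rpower (INR (n + 2) / INR (n + 1)) alpha) 1.
Proof.
  assert (L : is_lim_seq (fun n => INR (n + 2) / INR (n + 1)) 1).
  { apply is_lim_seq_ext with (fun n => 1 + / INR (S n)).
    { intros n. rewrite S_INR, !plus_INR. pose proof (pos_INR n). simpl. field. lra. }
    replace (Finite 1) with (Rbar_plus 1 0) by (simpl; f_equal; ring).
    apply is_lim_seq_plus'; [apply is_lim_seq_const|].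
    apply (is_lim_seq_incr_1 (fun n => / INR n)).
    replace (Finite 0) with (Rbar_inv p_infty) by easy.
    apply is_lim_seq_inv; [apply is_lim_seq_INR|easy]. }
  replace (Finite 1) with (Finite (Rpower 1 alpha))
    by (unfold Rpower; now rewrite ln_1, Rmult_0_r, exp_0).
  apply (is_lim_seq_continuous (fun x => Rpower x alpha)); [|exact L].
  apply derivable_continuous_pt. eexists. apply derivable_pt_lim_power. lra.
Qed.

Lemma ex_series_weight alpha r : 0 < r < 1 -> ex_series (weight alpha r).
Proof.
  intros Hr.
  assert (Hpos : forall n, 0 < weight alpha r n)
    by (intros; apply Rmult_lt_0_compat; [apply exp_pos|apply pow_lt; lra]).
  apply ex_series_Rabs. apply ex_series_DAlembert with r; [lra| |].
  - intros n. specialize (Hpos n). lra.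
  - apply is_lim_seq_ext with
      (fun n => r * Rpower (INR (n + 2) / INR (n + 1)) alpha).
    + intros n. rewrite Rabs_pos_eq.
      2:{ left. apply Rdiv_lt_0_compat; apply Hpos. }
      unfold weight. replace (S n + 1)%nat with (n + 2)%nat by lia.
      assert (H1 : 0 < INR (n + 1)) by (apply lt_0_INR; lia).
      assert (H2 : 0 < INR (n + 2)) by (apply lt_0_INR; lia).
      assert (0 < r ^ n) by (apply pow_lt; lra).
      pose proof (exp_pos (alpha * ln (INR (n + 1)))).
      unfold Rpower in *. rewrite ln_div, Rmult_minus_distr_l by easy.
      unfold Rminus. rewrite exp_plus, exp_Ropp. simpl. field. lra.
    + replace (Finite r) with (Rbar_mult r 1) by (simpl; f_equal; ring).
      now apply is_lim_seq_scal_l, is_lim_seq_Rpower_ratio.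
Qed.

Lemma ex_series_of_bounded_sums (u : nat -> R) M :
  (forall n, 0 <= u n) -> (forall n, sum_f_R0 u n <= M) ->
  ex_series u /\ Series u <= M.
Proof.
  intros Hu HM.
  assert (E : ex_series u).
  { destruct (ex_finite_lim_seq_incr (sum_n u) M) as [l Hl].
    - intros n. rewrite sum_Sn. specialize (Hu (S n)). unfold plus; simpl. lra.
    - intros n. rewrite sum_n_Reals. apply HM.
    - exists l. exact Hl. }
  split; [exact E|].
  apply (is_lim_seq_le (sum_n u) (fun _ => M) (Series u) M).
  - intros n. rewrite sum_n_Reals. apply HM.
  - apply (Series_correct u E).
  - apply is_lim_seq_const.
Qed.

Lemma Series_sum_switch (u : nat -> nat -> R) L :
  (forall n, ex_series (u n)) ->
  ex_series (fun m => sum_f_R0 (fun n => u n m) L) /\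
  Series (fun m => sum_f_R0 (fun n => u n m) L) = sum_f_R0 (fun n => Series (u n)) L.
Proof.
  intros Hu. induction L as [|L [IH1 IH2]]; [now split; [apply Hu|]|].
  simpl. split.
  - now apply (ex_series_plus (V := R_NormedModule)).
  - now rewrite Series_plus, IH2 by easy.
Qed.

Lemma ex_series_bounded_mult (c w : nat -> R) :
  (forall m, 0 <= c m <= 1) -> (forall m, 0 <= w m) -> ex_series w ->
  ex_series (fun m => c m * w m).
Proof.
  intros Hc Hw E. apply (ex_series_le (V := R_CompleteNormedModule)) with w; [|easy].
  intros m. change (Rabs (c m * w m) <= w m). specialize (Hc m). specialize (Hw m).
  rewrite Rabs_pos_eq by now apply Rmult_le_pos.
  rewrite <- (Rmult_1_l (w m)) at 2. apply Rmult_le_compat_r; lra.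
Qed.

Lemma kappa_le_1 c n m : 0 <= c -> kappa c n m <= 1.
Proof.
  intros Hc. unfold kappa. destruct (lt_dec _ _); [lra|].
  destruct (Nat.eq_dec _ _); [|lra]. rewrite <- Rinv_1. apply Rinv_le_contravar; lra.
Qed.

(** * Summing Carlson's inequalities *)

(** The total weight with which [|a_n| ^ 2] occurs when Carlson's inequality
    for each [m >= 1] is multiplied by [w m] and summed. *)
Lemma Series_kappa (c : R) (w : nat -> R) n :
  0 <= c -> (forall m, 0 <= w m) -> ex_series w -> (0 < n)%nat ->
  Series (fun j => kappa c n (S j) * w (S j)) =
  w (2 * n)%nat / (1 + c) + Series (fun k => w (2 * n + 1 + k)%nat).
Proof.
  intros Hc Hw E Hn.
  assert (E' : ex_series (fun m => kappa c n m * w m)).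
  { apply ex_series_bounded_mult; try easy.
    intros m; split; [now apply kappa_nonneg|now apply kappa_le_1]. }
  assert (Z : forall k, (k < 2 * n)%nat -> kappa c n k * w k = 0).
  { intros k Hk. unfold kappa.
    destruct (lt_dec (2 * n) k), (Nat.eq_dec (2 * n) k); lia || ring. }
  rewrite <- (Series_incr_1_aux (fun m => kappa c n m * w m)) by (apply Z; lia).
  rewrite (Series_incr_n_aux _ (2 * n) Z), Series_incr_1.
  2:{ now apply (ex_series_incr_n (fun m => kappa c n m * w m)). }
  f_equal.
  - rewrite Nat.add_0_r. unfold kappa. destruct (lt_dec _ _); [lia|].
    destruct (Nat.eq_dec _ _); [|lia]. field. lra.
  - apply Series_ext. intros k. replace (2 * n + 1 + k)%nat with (2 * n + S k)%nat by lia.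
    unfold kappa. destruct (lt_dec _ _); [ring|lia].
Qed.

(** Only sums over [m] are infinite at first: for the partial sum of [t] up to
    [L], the finite sum over [n] moves inside the series over [m]
    ([Series_sum_switch]), where Carlson's inequality applies term by term.
    The resulting bound does not depend on [L], which gives both the
    convergence of [t] and the estimate. *)
Lemma carlson_summed (x w : nat -> R) :
  (forall n, 0 <= x n) ->
  (forall m L, (0 < m)%nat ->
     x m + sum_f_R0 (fun k => kappa (x 0%nat) k m * x k ^ 2) L <= 1) ->
  (forall m, 0 <= w m) -> ex_series w ->
  let u := fun m => w (S m) * x (S m) in
  let t := fun k => x (S k) ^ 2 *
     (w (2 * S k)%nat / (1 + x 0%nat) + Series (fun j => w (2 * S k + 1 + j)%nat)) in
  ex_series u /\ ex_series t /\
  Series u + Series t <= (1 - x 0%nat ^ 2) * Series (fun m => w (S m)).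
Proof.
  intros Hx HC Hw E u t.
  assert (HC' : forall m L, x (S m) +
     sum_f_R0 (fun k => x (S k) ^ 2 * kappa (x 0%nat) (S k) (S m)) L <= 1 - x 0%nat ^ 2).
  { intros m L. specialize (HC (S m) (S L) ltac:(lia)).
    rewrite decomp_sum in HC by lia. simpl pred in HC.
    (* as [m >= 1], the term of index 0 is [x 0 ^ 2] *)
    replace (kappa (x 0%nat) 0 (S m)) with 1 in HC by reflexivity.
    rewrite (sum_eq _ (fun k => kappa (x 0%nat) (S k) (S m) * x (S k) ^ 2))
      by (intros; ring). lra. }
  assert (Ew : ex_series (fun m => w (S m))) by now apply (ex_series_incr_1 w).
  assert (Hs : forall m L,
     0 <= sum_f_R0 (fun k => x (S k) ^ 2 * kappa (x 0%nat) (S k) (S m)) L).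
  { intros m L. apply cond_pos_sum. intros k.
    apply Rmult_le_pos; [apply pow2_ge_0|now apply kappa_nonneg]. }
  assert (Eu : ex_series u).
  { apply (ex_series_ext (fun m => x (S m) * w (S m))); [intros; unfold u; apply Rmult_comm|].
    apply ex_series_bounded_mult; try easy. intros m. split; [easy|].
    specialize (HC' m 0%nat). specialize (Hs m 0%nat).
    pose proof (pow2_ge_0 (x 0%nat)). lra. }
  set (T := fun k m => x (S k) ^ 2 * (kappa (x 0%nat) (S k) (S m) * w (S m))).
  assert (Ht : forall k, t k = Series (T k)).
  { intros k. unfold T. rewrite Series_scal_l. unfold t.
    now rewrite Series_kappa by (easy || lia). }
  assert (Et : forall k, ex_series (T k)).
  { intros k. apply (ex_series_scal_l (V := R_NormedModule)).
    apply (ex_series_bounded_mult (fun m => kappa (x 0%nat) (S k) (S m))); try easy.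
    intros m; split; [now apply kappa_nonneg|now apply kappa_le_1]. }
  assert (Ht0 : forall k, 0 <= t k).
  { intros k. rewrite Ht, <- (Rmult_0_l (Series (fun _ => 0))), <- Series_scal_l.
    apply Series_le; [|apply Et]. intros m. split; [lra|]. rewrite Rmult_0_l.
    apply Rmult_le_pos; [apply pow2_ge_0|].
    apply Rmult_le_pos; [now apply kappa_nonneg|easy]. }
  destruct (ex_series_of_bounded_sums t
    ((1 - x 0%nat ^ 2) * Series (fun m => w (S m)) - Series u)) as [E1 E2]; [easy| |].
  - intros L. rewrite (sum_eq _ _ L (fun k _ => Ht k)).
    destruct (Series_sum_switch T L Et) as [F1 F2].
    rewrite <- F2. apply Rplus_le_reg_l with (Series u).
    rewrite <- Series_plus, <- Series_scal_l by easy.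
    replace (Series u + (Series (fun m => (1 - x 0%nat ^ 2) * w (S m)) - Series u))
      with (Series (fun m => (1 - x 0%nat ^ 2) * w (S m))) by ring.
    apply Series_le; [|now apply (ex_series_scal_l (V := R_NormedModule))].
    intros m.
    replace (u m + sum_f_R0 (fun k => T k m) L) with
      ((x (S m) + sum_f_R0 (fun k => x (S k) ^ 2 * kappa (x 0%nat) (S k) (S m)) L)
       * w (S m)).
    2:{ rewrite Rmult_plus_distr_r, (Rmult_comm (sum_f_R0 _ _)), scal_sum.
        unfold u. f_equal; [ring|]. apply sum_eq; intros; unfold T; ring. }
    split.
    + apply Rmult_le_pos; [|easy]. specialize (Hs m L). specialize (Hx (S m)). lra.
    + apply Rmult_le_compat_r; [easy|apply HC'].
  - split; [easy|split; [easy|lra]].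
Qed.

(** * The theorem *)

(** Concavity of [t ^ s]: with [z = s ln t], the convex combination with
    weights [s] and [1 - s] of the tangent bounds of [exp] at [z], taken at
    [ln t] and at [0]. *)
Lemma Rpower_le_tangent t s : 0 < t -> 0 <= s <= 1 -> Rpower t s <= 1 + s * (t - 1).
Proof.
  intros Ht Hs. set (l := ln t).
  assert (E : forall y z, exp z * (1 + (y - z)) <= exp y).
  { intros y z. replace y with (z + (y - z)) at 2 by ring. rewrite exp_plus.
    apply Rmult_le_compat_l; [left; apply exp_pos|].
    destruct (Req_dec (y - z) 0) as [->|Hn]; [rewrite exp_0; lra|].
    left. now apply exp_ineq1. }
  pose proof (E l (s * l)) as E1. pose proof (E 0 (s * l)) as E0.
  rewrite exp_0 in E0. replace (exp l) with t in E1 by (symmetry; now apply exp_ln).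
  unfold Rpower. fold l. set (e := exp (s * l)) in *.
  assert (s * (e * (1 + (l - s * l))) <= s * t) by (apply Rmult_le_compat_l; lra).
  assert ((1 - s) * (e * (1 + (0 - s * l))) <= (1 - s) * 1)
    by (apply Rmult_le_compat_l; lra).
  lra.
Qed.

Lemma rpow_le_tangent x p :
  0 <= x -> 0 < p <= 2 -> rpow x p + (1 - x ^ 2) * (p / 2) <= 1.
Proof.
  intros Hx Hp. unfold rpow. destruct (Req_EM_T x 0) as [->|H0]; [lra|].
  assert (Hx0 : 0 < x) by lra.
  replace (Rpower x p) with (Rpower (x ^ 2) (p / 2)).
  - pose proof (Rpower_le_tangent (x ^ 2) (p / 2) ltac:(now apply pow_lt) ltac:(lra)). lra.
  - rewrite <- Rpower_pow, Rpower_mult by easy. f_equal. simpl. field.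
Qed.

Theorem theorem2 (f : C -> C) (a : nat -> C) (p alpha R0 : R)
  (hf : classB f) (hfa : taylor_on_disk f a)
  (hp : 0 < p <= 2)
  (hR : is_min_root p alpha R0) :
  forall r : R, 0 <= r <= R0 ->
    ex_series (fun k => term1 a alpha r (S k)) /\
    ex_series (fun k => term2 a alpha r (S k)) /\
    rpow (Cmod (a 0%nat)) p
    + Series (fun k => term1 a alpha r (S k))
    + Series (fun k => term2 a alpha r (S k)) <= 1.
Proof.
  intros r Hr. destruct hf as [_ Hf]. destruct hR as [HR0 [HR _]].
  set (x := fun n => Cmod (a n)). set (w := weight alpha r).
  assert (Hx : forall n, 0 <= x n) by (intros; apply Cmod_ge_0).
  assert (Hw : forall n, 0 <= w n <= weight alpha R0 n)
    by (intros; split; [apply weight_nonneg|apply weight_monotone]; lra).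
  assert (ER0 := ex_series_weight alpha R0 HR0).
  assert (Ew : ex_series w).
  { apply (ex_series_le (V := R_CompleteNormedModule)) with (weight alpha R0); [|easy].
    intros n. change (Rabs (w n) <= weight alpha R0 n). rewrite Rabs_pos_eq; apply Hw. }
  assert (HPhi : Series (fun m => w (S m)) <= p / 2).
  { rewrite <- HR. unfold Phi.
    rewrite (Series_ext (fun k => _ * R0 ^ (1 + k)) (fun m => weight alpha R0 (S m))) by easy.
    apply Series_le; [intros; apply Hw|]. now apply (ex_series_incr_1 (weight alpha R0)). }
  destruct (carlson_summed x w Hx) as [E1 [E2 HS]]; try easy.
  { intros m L Hm. now apply (carlson f). }
  { intros m. apply Hw. }
  assert (T1 : forall m, w (S m) * x (S m) = term1 a alpha r (S m)).
  { intros m. unfold w, weight, term1, x. ring. }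
  assert (T2 : forall k, x (S k) ^ 2 *
     (w (2 * S k)%nat / (1 + x 0%nat) + Series (fun j => w (2 * S k + 1 + j)%nat))
     = term2 a alpha r (S k)) by easy.
  rewrite (Series_ext _ _ T1), (Series_ext _ _ T2) in HS.
  split; [exact (ex_series_ext _ _ T1 E1)|].
  split; [exact (ex_series_ext _ _ T2 E2)|].
  fold (x 0%nat).
  assert (Hx1 : x 0%nat <= 1).
  { pose proof (carlson f a 1 0 hfa Hf ltac:(lia)) as H1. simpl in H1.
    fold (x 1%nat) (x 0%nat) in H1. unfold kappa in H1; simpl in H1.
    pose proof (Hx 1%nat). pose proof (Hx 0%nat). nra. }
  pose proof (rpow_le_tangent (x 0%nat) p (Hx _) hp).
  assert ((1 - x 0%nat ^ 2) * Series (fun m => w (S m)) <= (1 - x 0%nat ^ 2) * (p / 2)).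
  { apply Rmult_le_compat_l; [|easy]. pose proof (Hx 0%nat). nra. }
  lra.
Qed.
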